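(* Let $G$ be a finite graph with arbitrary probabilities on its edges, let $0,b\in G$ be two vertices and let $A\subset G$ be a set of vertices with $|A|=2$. Then $$\mathbb{P}(0\leftrightarrow b,\ 0\leftrightarrow A)\ \ge\ \min\{\mathbb{P}(0\leftrightarrow A,\ a\leftrightarrow b): a\in A\}.$$
   Context: A graph is identified with its vertex set. Each edge $e\in E(G)$ carries a number $p(e)\in[0,1]$, and $\omega\subseteq E(G)$ is a random set of edges in which every edge $e$ is included (is ''open'') with probability $p(e)$, independently; $\mathbb{P}$ is the resulting probability measure (percolation measure). $v\leftrightarrow w$ denotes the event that $v$ and $w$ are connected by a path of open edges (or $v=w$). For a set of vertices $A$, $v\leftrightarrow A$ means $v\leftrightarrow a$ for some $a\in A$. *)

(* Defs.v *)
From mathcomp Require Import all_boot all_order all_algebra.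
From mathcomp Require Import reals.

Set Implicit Arguments.
Unset Strict Implicit.
Unset Printing Implicit Defensive.
Import Order.TTheory GRing.Theory Num.Theory.
Local Open Scope ring_scope.

Record sgraph := SGraph {
  vertex :> finType;
  adj : rel vertex;
  adj_sym : symmetric adj;
  adj_irr : irreflexive adj
}.

Section Percolation.
Variables (R : realType) (G : sgraph).

(* Edges are unordered pairs; they have exactly two elements by [adj_irr]. *)
Definition edges : {set {set G}} :=
  [set [set x.1; x.2] | x : G * G & adj x.1 x.2].

Implicit Types (p : {set G} -> R) (w : {set {set G}}).

Definition edge_probability p : Prop :=
  forall e, e \in edges -> 0 <= p e <= 1.

(* [connect] is the reflexive transitive closure, so v <-> v always holds. *)
Definition open_connected w (v u : G) : bool :=
  connect [rel x y | [set x; y] \in w] v u.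

Definition open_connected_set w (v : G) (A : {set G}) : bool :=
  [exists a in A, open_connected w v a].

(* The values of p outside [edges] play no role. *)
Definition config_weight p w : R :=
  \prod_(e in edges) (if e \in w then p e else 1 - p e).

Definition percolation p (event : pred {set {set G}}) : R :=
  \sum_(w in powerset edges | event w) config_weight p w.

(* All joint laws are determined by these values, so this says that the edges are
   open independently with probabilities p; F empty gives total mass 1. *)
Lemma percolation_open p (F : {set {set G}}) : F \subset edges ->
  percolation p (fun w => F \subset w) = \prod_(e in F) p e.
Proof.
move=> sFE; pose f e := if e \in edges then p e else 0.
pose g e := if e \in edges then (if e \in F then 0 else 1 - p e) else 1.
have -> : \prod_(e in F) p e = \prod_e (f e + g e).
  rewrite big_mkcond; apply: eq_bigr => e _; rewrite /f /g.
  case: ifP => [eF|_]; first by rewrite (subsetP sFE) // addr0.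
  by case: ifP => _; rewrite ?add0r // addrC subrK.
rewrite bigA_distr /percolation big_mkcond; apply: eq_bigr => w _ /=.
case: ifP => [/andP[]|wN].
  rewrite powersetE => swE sFw; rewrite /config_weight big_mkcond.
  apply: eq_bigr => e _; rewrite /f /g.
  case: ifPn => [eE|eNE]; case: ifPn => // ew.
    by rewrite ifN //; apply: contra ew; apply: (subsetP sFw).
  by move: eNE; rewrite (subsetP swE).
symmetry; move/negbT: wN; rewrite powersetE negb_and => /orP[] /subsetPn[e e1 e2].
  by rewrite (bigD1 e) //= e1 /f ifN // mul0r.
by rewrite (bigD1 e) //= ifN // /g (subsetP sFE) // e1 mul0r.
Qed.

(* Hence 1 is a neutral initial value for a minimum of probabilities. *)
Lemma percolation_le1 p (event : pred {set {set G}}) :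
  edge_probability p -> percolation p event <= 1.
Proof.
move=> hp; have <- : percolation p (fun w => set0 \subset w) = 1.
  by rewrite percolation_open ?sub0set // big_set0.
rewrite /percolation [leRHS]big_mkcondr [leLHS]big_mkcondr.
apply: ler_sum => w _; rewrite sub0set; case: ifP => // _.
apply: prodr_ge0 => e /hp /andP[p0 p1].
by case: ifP => _ //; rewrite subr_ge0.
Qed.

End Percolation.

(* Main.v *)
(** Let [A = {x, y}].  The inequality with [a = x] fails iff
    [P(oby|x) < P(oy|xb)], where the bar separates distinct clusters, and
    symmetrically for [a = y].  Conditionally on x and y being disconnected, the
    events [o <-> y] and [b <-> y] are positively correlated, while [o <-> y]
    and [b <-> x] are negatively correlated (van den Berg, Haggstrom, Kahn).
    Hence a failure at [x] forces [P(b <-> y, x|y) < P(b <-> x, x|y)], and a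
    failure at [y] the reverse.

    Both correlations follow from
    [P(N <-> a, N|T) P(M <-> b, M|T)
       <= P(N <-> a, M <-> b, (N u M)|T) P((N n M)|T)],
    proved by revealing one edge at a time: first the edges at [N n M], an open
    edge adding its other end to both [N] and [M]; then the edges at [T]; what
    remains is Harris' inequality. *)

Require Import Defs.
From mathcomp Require Import all_boot all_order all_algebra.
From mathcomp Require Import reals.
From mathcomp Require Import ring lra.

Set Implicit Arguments.
Unset Strict Implicit.
Unset Printing Implicit Defensive.
Import Order.TTheory GRing.Theory Num.Theory.
Local Open Scope ring_scope.

(** * Inequalities for a single Bernoulli variable *)

Section TwoPoint.
Variable R : realType.
Implicit Types q x y z : R.

(** When each [z] equals the product, the two sides differ by the covariance
    [q * (1 - q) * (x1 - x0) * (y1 - y0)]. *)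
Lemma chebyshev2 q x0 x1 y0 y1 z0 z1 : 0 <= q <= 1 ->
  x0 <= x1 -> y0 <= y1 -> x0 * y0 <= z0 -> x1 * y1 <= z1 ->
  (q * x1 + (1 - q) * x0) * (q * y1 + (1 - q) * y0) <= q * z1 + (1 - q) * z0.
Proof.
move=> /andP[q0 q1] x01 y01 h0 h1.
have c : 0 <= q * (1 - q) * ((x1 - x0) * (y1 - y0)).
  by rewrite !mulr_ge0 ?subr_ge0.
have c1 : 0 <= q * (z1 - x1 * y1) by rewrite mulr_ge0 ?subr_ge0.
have c0 : 0 <= (1 - q) * (z0 - x0 * y0) by rewrite mulr_ge0 ?subr_ge0.
lra.
Qed.

(** A one-edge four-function inequality: both mixed products are bounded by [z1 * t0], where the
    edge is open for [z] and closed for [t]. *)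
Lemma four_functions2 q x0 x1 y0 y1 z0 z1 t0 t1 : 0 <= q <= 1 ->
  0 <= x0 -> 0 <= x1 -> 0 <= y0 -> 0 <= y1 ->
  0 <= z0 -> 0 <= z1 -> 0 <= t0 -> 0 <= t1 ->
  x0 * y0 <= z0 * t0 -> x1 * y1 <= z1 * t1 ->
  x1 * y0 <= z1 * t0 -> x0 * y1 <= z1 * t0 ->
  (q * x1 + (1 - q) * x0) * (q * y1 + (1 - q) * y0)
    <= (q * z1 + (1 - q) * z0) * (q * t1 + (1 - q) * t0).
Proof.
move=> /andP[q0 q1] x0p x1p y0p y1p z0p z1p t0p t1p h00 h11 h10 h01.
(* For [A = z1 * t0 > 0], expanding [(A - x1 * y0) * (A - x0 * y1) >= 0] bounds [A] times the left
   side by [A ^+ 2] plus the product of the mixed terms. The diagonal hypotheses bound that product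
   by [A * (z0 * t1)]. *)
have mixed : x1 * y0 + x0 * y1 <= z1 * t0 + z0 * t1.
  have := mulr_ge0 z1p t0p; rewrite le_eqVlt => /orP[/eqP A0|A0].
    by have := mulr_ge0 z0p t1p; lra.
  rewrite -(ler_pM2l A0).
  have : 0 <= (z1 * t0 - x1 * y0) * (z1 * t0 - x0 * y1).
    by rewrite mulr_ge0 ?subr_ge0.
  have : (x0 * y0) * (x1 * y1) <= (z0 * t0) * (z1 * t1).
    by apply: ler_pM => //; apply: mulr_ge0.
  lra.
have c : 0 <= q * (1 - q) * (z1 * t0 + z0 * t1 - (x1 * y0 + x0 * y1)).
  by rewrite !mulr_ge0 ?subr_ge0.
have c1 : 0 <= q ^+ 2 * (z1 * t1 - x1 * y1).
  by rewrite mulr_ge0 ?sqr_ge0 ?subr_ge0.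
have c0 : 0 <= (1 - q) ^+ 2 * (z0 * t0 - x0 * y0).
  by rewrite mulr_ge0 ?sqr_ge0 ?subr_ge0.
lra.
Qed.

End TwoPoint.

(** * Product measures and Harris' inequality *)

Section ProductMeasure.
Variables (R : realType) (I : finType) (p : I -> R).
Implicit Types (E w : {set I}) (P Q : pred {set I}).

(** [percolation] with a free ground set, so that inductions can delete edges; at [edges G] the two
    are convertible. *)
Definition prob E P : R :=
  \sum_(w in powerset E | P w)
    \prod_(e in E) (if e \in w then p e else 1 - p e).

Lemma eq_prob E P Q : (forall w, w \subset E -> P w = Q w) ->
  prob E P = prob E Q.
Proof.
move=> PQ; apply: eq_bigl => w; rewrite powersetE.
by case: (boolP (w \subset E)) => // /PQ.
Qed.

Lemma prob_split E P Q :
  prob E P = prob E (predI P Q) + prob E (predI P (predC Q)).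
Proof.
by rewrite /prob (bigID Q) /=; congr (_ + _); apply: eq_bigl => w /=;
  rewrite andbA.
Qed.

Lemma prob_pred0 E : prob E pred0 = 0.
Proof. by apply: big_pred0 => w /=; rewrite andbF. Qed.

(** Conditioning on the state of [e]: this is how an edge gets revealed. *)
Lemma probD1 E e P : e \in E ->
  prob E P = p e * prob (E :\ e) (fun w => P (e |: w))
             + (1 - p e) * prob (E :\ e) P.
Proof.
move=> eE; rewrite /prob (bigID (fun w => e \in w)) /=; congr (_ + _).
  rewrite (reindex_onto (fun w => e |: w) (fun w => w :\ e)) /=; last first.
    by move=> w /andP[_ ew]; rewrite setD1K.
  rewrite big_distrr /=; apply: eq_big => w.
    rewrite !powersetE setU11 andbT subUset sub1set eE /= subsetD1.
    have -> : ((e |: w) :\ e == w) = (e \notin w).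
      by apply/eqP/idP => [<-|/setU1K //]; rewrite !inE eqxx.
    by rewrite -!andbA; congr (_ && _); rewrite andbC.
  move=> /andP[_ /eqP ew]; rewrite (big_setD1 e) //= setU11; congr (_ * _).
  by apply: eq_bigr => f; rewrite !inE => /andP[/negPf -> _].
rewrite big_distrr /=; apply: eq_big => w.
  by rewrite !powersetE subsetD1; case: (e \in w); rewrite ?andbF ?andbT.
by move=> /andP[_ /negPf ew]; rewrite (big_setD1 e) //= ew.
Qed.

Lemma prob_set0 P : prob set0 P = (P set0)%:R.
Proof.
by rewrite /prob big_mkcondr powerset0 big_set1 big_set0; case: (P set0).
Qed.

Lemma prob_predT E : prob E predT = 1.
Proof.
have [n] := ubnP #|E|; elim: n E => // n IHn E leEn.
have [->|[e eE]] := set_0Vmem E; first by rewrite prob_set0.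
rewrite (probD1 _ eE) -[prob _ (fun _ => _)]/(prob (E :\ e) predT) IHn;
  first by ring.
by rewrite (cardsD1 e) eE in leEn.
Qed.

Lemma prob_le E P Q : (forall e, e \in E -> 0 <= p e <= 1) ->
  (forall w, w \subset E -> P w -> Q w) -> prob E P <= prob E Q.
Proof.
move=> hp PQ; rewrite /prob [leLHS]big_mkcondr [leRHS]big_mkcondr.
apply: ler_sum => w; rewrite powersetE => /PQ.
case: (P w) => [->//|_]; case: (Q w) => //.
apply: prodr_ge0 => e /hp /andP[p0 p1].
by case: ifP => _ //; rewrite subr_ge0.
Qed.

Lemma prob_ge0 E P : (forall e, e \in E -> 0 <= p e <= 1) -> 0 <= prob E P.
Proof. by move=> hp; rewrite -(prob_pred0 E); apply: prob_le. Qed.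

(** After revealing an edge, both events are still increasing, and both are likelier when it is
    open, so [chebyshev2] combines the two cases. *)
Lemma harris E P Q : (forall e, e \in E -> 0 <= p e <= 1) ->
  (forall w w', w \subset w' -> P w -> P w') ->
  (forall w w', w \subset w' -> Q w -> Q w') ->
  prob E P * prob E Q <= prob E (predI P Q).
Proof.
have [n] := ubnP #|E|; elim: n E P Q => // n IHn E P Q leEn hp incP incQ.
have [->|[e eE]] := set_0Vmem E.
  by rewrite !prob_set0 /=; case: (P _); case: (Q _); rewrite ?mulr1 ?mulr0.
have hp' f : f \in E :\ e -> 0 <= p f <= 1 by move=> /setD1P[_ /hp].
have leE' : (#|E :\ e| < n)%N by rewrite (cardsD1 e) eE in leEn.
rewrite !(probD1 _ eE).
pose up (S : pred {set I}) w := S (e |: w).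
have incU (S : pred {set I}) : (forall w w', w \subset w' -> S w -> S w') ->
    forall w w', w \subset w' -> up S w -> up S w'.
  by move=> incS w w' /(setUS [set e]); apply: incS.
apply: chebyshev2; [exact: hp| | |exact: IHn|].
- by apply: prob_le => // w _; apply/incP/subsetU1.
- by apply: prob_le => // w _; apply/incQ/subsetU1.
- exact: (IHn _ (up P) (up Q) leE' hp' (incU _ incP) (incU _ incQ)).
Qed.

End ProductMeasure.

(** * Clusters of seed sets and their separation *)

Section Exploration.
Variable G : sgraph.
Implicit Types (w : {set {set G}}) (N M T : {set G}) (a b u v z : G).

(** Seeds form a set because revealing an open edge at a seed adds its other end to the seeds. *)
Definition reach w N a := [exists v in N, open_connected w v a].

Definition avoid w N T := ~~ [exists t in T, reach w N t].

Lemma open_connected_sym w : connect_sym [rel x y : G | [set x; y] \in w].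
Proof. by apply: sym_connect_sym => x y /=; rewrite setUC. Qed.

Lemma reach_mem w N z : z \in N -> reach w N z.
Proof. by move=> zN; apply/exists_inP; exists z => //; apply: connect0. Qed.

Lemma reach_step w N z z' : reach w N z -> [set z; z'] \in w -> reach w N z'.
Proof.
case/exists_inP => v vN vz zz'; apply/exists_inP; exists v => //.
by apply: connect_trans vz _; apply: connect1.
Qed.

Lemma reach_ind w N (S : pred G) a : (forall z, z \in N -> S z) ->
  (forall z z', S z -> [set z; z'] \in w -> S z') -> reach w N a -> S a.
Proof.
move=> subNS stepS /exists_inP[v /subNS Sv /connectP[s]].
elim: s v Sv => [|z s IHs] v Sv /=; first by move=> _ ->.
by case/andP=> /(stepS _ _ Sv) /IHs IH /IH.
Qed.

Lemma reach_mono w w' N N' a : w \subset w' -> N \subset N' ->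
  reach w N a -> reach w' N' a.
Proof.
move=> /subsetP ww' /subsetP NN'; apply: reach_ind => [z /NN'|z z' rz /ww'].
  exact: reach_mem.
exact: reach_step.
Qed.

Lemma avoidPn w N T :
  reflect (exists2 t, t \in T & reach w N t) (~~ avoid w N T).
Proof. by rewrite negbK; apply: exists_inP. Qed.

Lemma avoid_mono w w' N N' T T' : w \subset w' -> N \subset N' ->
  T \subset T' -> avoid w' N' T' -> avoid w N T.
Proof.
move=> ww' NN' /subsetP TT'; apply: contraLR => /avoidPn[t /TT' tT' rt].
by apply/avoidPn; exists t => //; apply: reach_mono rt.
Qed.

Lemma avoidC w N T : avoid w N T = avoid w T N.
Proof.
apply: negb_inj; apply/avoidPn/avoidPn => -[t tT /exists_inP[v vN vt]];
  exists v => //; apply/exists_inP; exists t => //;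
  by rewrite /open_connected open_connected_sym.
Qed.

Lemma avoidU w N M T : avoid w (N :|: M) T = avoid w N T && avoid w M T.
Proof.
rewrite !(avoidC w _ T); apply/idP/andP.
  by move=> av; split; apply: avoid_mono av; rewrite ?subsetUl ?subsetUr.
case=> avN avM; apply/negP => /exists_inP[z /setUP[] zNM rz].
  by case/avoidPn: avN; exists z.
by case/avoidPn: avM; exists z.
Qed.

Lemma open_connectedC w u v : open_connected w u v = open_connected w v u.
Proof. exact: open_connected_sym. Qed.

Lemma reach1 w u v : reach w [set u] v = open_connected w u v.
Proof.
apply/exists_inP/idP => [[z /set1P-> //]|uv].
by exists u; rewrite ?set11.
Qed.

Lemma avoid11 w u v : avoid w [set u] [set v] = ~~ open_connected w u v.
Proof.
apply: negb_inj; rewrite negbK -reach1; apply/avoidPn/idP.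
  by case=> z /set1P->.
move=> uv.
by exists v; rewrite ?set11.
Qed.

(** As [v] is already a seed, all that the open edge can contribute is to make [u] reached. *)
Lemma reach_open_edge w N v u a : v \in N ->
  reach ([set v; u] |: w) N a = reach w (u |: N) a.
Proof.
move=> vN; apply/idP/idP; apply: reach_ind => [z zN|z z' rz].
- by apply: reach_mem; apply: setU1r.
- case/setU1P => [zz'|]; last exact: reach_step.
  have : z' \in [set v; u] by rewrite -zz' set22.
  by case/set2P => ->; apply: reach_mem; rewrite !inE ?vN ?eqxx ?orbT.
- case/setU1P: zN => [->|/reach_mem //].
  by apply: (@reach_step _ _ v); [exact: reach_mem | exact: setU11].
- by move=> zz'; apply: reach_step rz _; apply: setU1r.
Qed.

Lemma avoid_open_edge w N T v u : v \in N ->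
  avoid ([set v; u] |: w) N T = avoid w (u |: N) T.
Proof.
by move=> vN; congr (~~ _); apply: eq_existsb => t; rewrite reach_open_edge.
Qed.

(** The event written [N <-> a, N|T] in the overview. *)
Definition reach_avoid N a T w := reach w N a && avoid w N T.
Arguments reach_avoid : simpl never.

Lemma reach_avoid_open_source w N a T v u : v \in N ->
  reach_avoid N a T ([set v; u] |: w) = reach_avoid (u |: N) a T w.
Proof.
by move=> vN; rewrite /reach_avoid reach_open_edge // avoid_open_edge.
Qed.

(** Both ends of the edge lie in [u |: T], so a path from [N] that avoids this set cannot cross
    it. *)
Lemma reach_avoid_open_target w N a T v u : v \in T ->
  reach_avoid N a T ([set v; u] |: w) = reach_avoid N a (u |: T) w.
Proof.
move=> vT; rewrite /reach_avoid avoidC avoid_open_edge // avoidC.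
apply: andb_id2r => Nav; apply/idP/idP; last by apply/reach_mono/subxx/subsetU1.
apply: reach_ind => [z|z z' rz /setU1P[zz'|]]; first exact: reach_mem.
  case/avoidPn: Nav; exists z => //.
  have : z \in [set v; u] by rewrite -zz' set21.
  by case/set2P => ->; rewrite !inE ?vT ?eqxx ?orbT.
exact: reach_step.
Qed.

(** Without open edges at [T], the cluster of [T] is [T] itself. *)
Lemma avoid_isolated w N T : (forall e, e \in w -> [disjoint e & T]) ->
  avoid w N T = [disjoint N & T].
Proof.
move=> isoT; rewrite avoidC; apply: negb_inj; apply/avoidPn/pred0Pn.
  case=> v vN vT; exists v => /=; rewrite vN /=.
  apply: (@reach_ind w T (fun z => z \in T)) vT => // z z' zT /isoT /disjointFr.
  by move=> /(_ z (set21 _ _)); rewrite zT.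
by case=> v /andP[vN vT]; exists v => //; apply: reach_mem.
Qed.

(** * Correlation inequalities for separated clusters *)

Section Correlation.
Variables (R : realType) (p : {set G} -> R).
Hypothesis hp : edge_probability p.
Implicit Type E : {set {set G}}.

Let sub_prob E : E \subset edges G -> forall e, e \in E -> 0 <= p e <= 1.
Proof. by move=> /subsetP sE e /sE /hp. Qed.

Lemma edge_endpoint E e v : E \subset edges G -> e \in E -> v \in e ->
  exists u, e = [set v; u].
Proof.
move=> /subsetP sE /sE /imsetP[[x y] _ -> /=] /set2P[] ->; first by exists y.
by exists x; rewrite setUC.
Qed.

(** The dichotomy behind both inductions: either no edge is left at [T], or there is one to
    reveal. *)
Lemma incident_edge E T : E \subset edges G ->
  (forall w e, w \subset E -> e \in w -> [disjoint e & T]) \/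
  exists v u, v \in T /\ [set v; u] \in E.
Proof.
move=> sE; have [/existsP[e /andP[eE /pred0Pn[v /andP[ve vT]]]]|noE] :=
    boolP [exists e, (e \in E) && ~~ [disjoint e & T]].
  have [u eE'] := edge_endpoint sE eE ve.
  by right; exists v, u; rewrite -eE'.
left=> w e /subsetP wE /wE eE; apply: contraNT noE => eT.
by apply/existsP; exists e; rewrite eE.
Qed.

(** Edges at [T] are revealed; an open one enlarges [T] and so makes both events less likely. When
    none is left, avoiding [T] is deterministic and the events are increasing, as Harris' inequality
    requires. *)
Lemma reach_avoid_correlation E N M T a b : E \subset edges G ->
  prob p E (reach_avoid N a T) * prob p E (reach_avoid M b T)
    <= prob p E (predI (reach_avoid N a T) (reach_avoid M b T)).
Proof.
have [n] := ubnP #|E|; elim: n E T => // n IHn E T leEn sE.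
have [isoT|[v [u [vT eE]]]] := incident_edge T sE.
  have avE K c w : w \subset E ->
      reach_avoid K c T w = [disjoint K & T] && reach w K c.
    by move=> wE; rewrite /reach_avoid (avoid_isolated _ (isoT w ^~ wE)) andbC.
  rewrite (eq_prob _ (avE N a)) (eq_prob _ (avE M b)).
  have -> : prob p E (predI (reach_avoid N a T) (reach_avoid M b T)) =
      prob p E (predI (fun w => [disjoint N & T] && reach w N a)
                      (fun w => [disjoint M & T] && reach w M b)).
    by apply: eq_prob => w wE /=; rewrite !avE.
  by apply: harris => [|w w' ww' /andP[-> /=]|w w' ww' /andP[-> /=]];
    [exact: sub_prob | exact: reach_mono | exact: reach_mono].
set e := [set v; u] in eE; have sE' : E :\ e \subset edges G.
  by apply: subset_trans sE; apply: subsetDl.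
have leE' : (#|E :\ e| < n)%N by rewrite (cardsD1 e) eE in leEn.
have decT K c : prob p (E :\ e) (reach_avoid K c (u |: T)) <=
    prob p (E :\ e) (reach_avoid K c T).
  apply: prob_le => [|w _ /andP[rw aw]]; first exact: sub_prob.
  by rewrite /reach_avoid rw; apply: avoid_mono aw; rewrite ?subsetU1.
rewrite !(probD1 _ _ eE).
have openT (K : {set G}) c :
    prob p (E :\ e) (fun w => reach_avoid K c T (e |: w)) =
    prob p (E :\ e) (reach_avoid K c (u |: T)).
  by apply: eq_prob => w _; rewrite reach_avoid_open_target.
have openJ : prob p (E :\ e) (fun w => predI (reach_avoid N a T)
        (reach_avoid M b T) (e |: w)) =
    prob p (E :\ e) (predI (reach_avoid N a (u |: T))
                           (reach_avoid M b (u |: T))).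
  by apply: eq_prob => w _ /=; rewrite !reach_avoid_open_target.
rewrite !openT openJ.
(* Opening [e] disfavours both events, so in [chebyshev2] the upper state is the closed one, of
   probability [1 - p e]. *)
have q01 : 0 <= 1 - p e <= 1.
  by have /andP[p0 p1] := sub_prob sE eE; rewrite subr_ge0 gerBl p0 p1.
have := chebyshev2 q01 (decT N a) (decT M b) (IHn _ (u |: T) leE' sE')
  (IHn _ T leE' sE').
by rewrite subKr !(addrC ((1 - p e) * _)).
Qed.

(* The factor [N :&: M] absorbs the two mixed terms in which the edge is open in
   only one of the two configurations. *)
Lemma reach_avoid_four_functions E N M T a b : E \subset edges G ->
  prob p E (reach_avoid N a T) * prob p E (reach_avoid M b T)
    <= prob p E (predI (reach_avoid N a T) (reach_avoid M b T))
       * prob p E (fun w => avoid w (N :&: M) T).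
Proof.
have [n] := ubnP #|E|; elim: n E N M => // n IHn E N M leEn sE.
have [isoNM|[v [u [/setIP[vN vM] eE]]]] := incident_edge (N :&: M) sE.
  rewrite [X in _ <= _ * X](@eq_prob _ _ _ _ _
    (fun _ => [disjoint T & N :&: M])); last first.
    by move=> w wE; rewrite avoidC (avoid_isolated _ (isoNM w ^~ wE)).
  (* The last factor is now 1 or 0; if it is 0, a seed of [N] lying in [T] makes the left side
     vanish too. *)
  have [disTNM|/pred0Pn[t /andP[tT /setIP[tN _]]]] :=
    boolP [disjoint T & N :&: M].
    by rewrite prob_predT mulr1 reach_avoid_correlation.
  rewrite prob_pred0 mulr0.
  rewrite (@eq_prob _ _ _ _ (reach_avoid N a T) pred0) ?prob_pred0 ?mul0r //.
  move=> w _; apply/negbTE/nandP; right; apply/avoidPn.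
  by exists t => //; apply: reach_mem.
set e := [set v; u] in eE; have sE' : E :\ e \subset edges G.
  by apply: subset_trans sE; apply: subsetDl.
have hp' := sub_prob sE'.
have leE' : (#|E :\ e| < n)%N by rewrite (cardsD1 e) eE in leEn.
pose J N' M' := predI (reach_avoid N' a T) (reach_avoid M' b T).
pose Z K w := avoid w K T.
rewrite !(probD1 _ _ eE).
have openF (K : {set G}) c : v \in K ->
    prob p (E :\ e) (fun w => reach_avoid K c T (e |: w)) =
    prob p (E :\ e) (reach_avoid (u |: K) c T).
  by move=> vK; apply: eq_prob => w _; rewrite reach_avoid_open_source.
have openJ : prob p (E :\ e) (fun w => J N M (e |: w)) =
    prob p (E :\ e) (J (u |: N) (u |: M)).
  by apply: eq_prob => w _ /=; rewrite !reach_avoid_open_source.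
have openZ : prob p (E :\ e) (fun w => Z (N :&: M) (e |: w)) =
    prob p (E :\ e) (Z ((u |: N) :&: (u |: M))).
  by apply: eq_prob => w _; rewrite /Z avoid_open_edge ?inE ?vN // setUIr.
rewrite (openF N) // (openF M) // openJ openZ.
have IH N' M' := IHn (E :\ e) N' M' leE' sE'.
(* For the mixed terms, where only one seed set gains [u]: the union of the seeds is as if both had
   gained it, which gives [J], and the intersection still contains [N :&: M], which gives [Z]. *)
have leJZ N1 M1 : N :&: M \subset N1 :&: M1 ->
    N1 \subset u |: N -> M1 \subset u |: M ->
    (u |: N) :|: (u |: M) \subset N1 :|: M1 ->
    prob p (E :\ e) (reach_avoid N1 a T) * prob p (E :\ e) (reach_avoid M1 b T)
    <= prob p (E :\ e) (J (u |: N) (u |: M)) * prob p (E :\ e) (Z (N :&: M)).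
  move=> sI sN sM sU; apply: le_trans (IH N1 M1) _.
  apply: ler_pM; rewrite ?prob_ge0 //; apply: prob_le => // w _; last first.
    exact: avoid_mono.
  move=> /andP[/andP[ra aN] /andP[rb aM]]; rewrite /= /reach_avoid.
  rewrite (reach_mono _ sN ra) // (reach_mono _ sM rb) //= -avoidU.
  by apply: avoid_mono (_ : avoid w (N1 :|: M1) T); rewrite // avoidU aN aM.
apply: four_functions2; rewrite ?prob_ge0 ?IH //; first exact: sub_prob sE _ eE.
- by apply: leJZ; rewrite ?subsetU1 // ?setSI ?subsetU1 // subUset subsetUl /=
    subUset subsetUr sub1set !inE eqxx.
- by apply: leJZ; rewrite ?subsetU1 // ?setIS ?subsetU1 // subUset subsetUr andbT
    subUset subsetUl sub1set !inE eqxx orbT.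
Qed.

(* Apply the four-function inequality to the seeds [{x, o}] and [{x}] and pass
   to the complement of "o is separated from y". *)
Lemma cross_correlation E o b x y : E \subset edges G ->
  prob p E (predI (reach_avoid [set y] o [set x]) (reach_avoid [set x] b [set y]))
    * prob p E (fun w => avoid w [set x] [set y])
  <= prob p E (reach_avoid [set y] o [set x])
     * prob p E (reach_avoid [set x] b [set y]).
Proof.
move=> sE; pose far w := avoid w [set x; o] [set y].
have farE w : far w = avoid w [set x] [set y] && ~~ open_connected w y o.
  by rewrite /far avoidU !avoid11 (open_connectedC w o).
(* The target [x] is itself a seed, so the first factor becomes [P(far)]. *)
have := reach_avoid_four_functions [set x; o] [set x] [set y] x b sE.
rewrite (setIidPr (subsetUl [set x] [set o])).
rewrite (prob_split p E (fun w => avoid w [set x] [set y]) far).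
rewrite (prob_split p E (reach_avoid [set x] b [set y]) far).
have -> : prob p E (reach_avoid [set x; o] x [set y]) =
    prob p E (predI (fun w => avoid w [set x] [set y]) far).
  apply: eq_prob => w _ /=; rewrite /reach_avoid reach_mem ?set21 //=.
  by rewrite -/(far w) farE andbA andbb.
have -> : prob p E (predI (reach_avoid [set x; o] x [set y])
      (reach_avoid [set x] b [set y])) =
    prob p E (predI (reach_avoid [set x] b [set y]) far).
  apply: eq_prob => w _ /=; rewrite /reach_avoid reach_mem ?set21 //=.
  by rewrite andbC.
have -> : prob p E (predI (reach_avoid [set y] o [set x])
      (reach_avoid [set x] b [set y])) =
    prob p E (predI (reach_avoid [set x] b [set y]) (predC far)).
  apply: eq_prob => w _ /=; rewrite farE /reach_avoid !reach1 (avoidC _ [set y]).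
  by case: (avoid _ _ _); case: (open_connected w y o); rewrite ?andbF ?andbT.
have -> : prob p E (reach_avoid [set y] o [set x]) =
    prob p E (predI (fun w => avoid w [set x] [set y]) (predC far)).
  apply: eq_prob => w _ /=; rewrite farE /reach_avoid !reach1 (avoidC _ [set y]).
  by case: (avoid _ _ _); case: (open_connected w y o).
(* Expanded along [far], hypothesis and goal reduce to the same inequality once the product common
   to both sides is cancelled. *)
lra.
Qed.

(** With [same = P(oby|x)], [cross = P(oy|xb)], [oy = P(oy|x)] and [d = P(x|y)], the chain is [oy *
    P(by|x) <= same * d < cross * d <= oy * P(bx|y)], and [oy] cancels. *)
Lemma closer_endpoint o b x y :
  percolation p
      (fun w => open_connected w o b && open_connected_set w o [set x; y])
    < percolation p
        (fun w => open_connected_set w o [set x; y] && open_connected w x b) ->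
  prob p (edges G) (reach_avoid [set y] b [set x])
    < prob p (edges G) (reach_avoid [set x] b [set y]).
Proof.
set L := fun w => _; set X := fun w => _.
rewrite -[percolation p L]/(prob p (edges G) L).
rewrite -[percolation p X]/(prob p (edges G) X).
rewrite (prob_split p _ L X) (prob_split p _ X L).
have -> : prob p (edges G) (predI L X) = prob p (edges G) (predI X L).
  by apply: eq_prob => w _; apply: andbC.
rewrite ltrD2l.
(* Cluster representatives turn connections into equalities, so the event identities below become
   case analyses closed by congruence. *)
pose r w := fingraph.root [rel x y : G | [set x; y] \in w].
have connE w u v : open_connected w u v = (r w u == r w v).
  by rewrite /r (root_connect (open_connected_sym w)).
have conn2 w u : open_connected_set w u [set x; y] =
    open_connected w u x || open_connected w u y.
  apply/exists_inP/orP => [[z /set2P[] -> h]|[] h]; first by left.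
  - by right.
  - by exists x; rewrite ?set21.
  - by exists y; rewrite ?set22.
have -> : prob p (edges G) (predI L (predC X)) = prob p (edges G)
    (predI (reach_avoid [set y] o [set x]) (reach_avoid [set y] b [set x])).
  apply: eq_prob => w _; rewrite /= /L /X /reach_avoid !reach1 avoid11.
  rewrite conn2 !connE.
  move: (r w o) (r w b) (r w x) (r w y) => ro rb rx ry.
  by case: (ry =P ro); case: (ro =P rx); case: (ro =P ry); case: (ro =P rb);
    case: (rx =P rb); case: (ry =P rb); case: (ry =P rx) => //= *; congruence.
have -> : prob p (edges G) (predI X (predC L)) = prob p (edges G)
    (predI (reach_avoid [set y] o [set x]) (reach_avoid [set x] b [set y])).
  apply: eq_prob => w _; rewrite /= /L /X /reach_avoid !reach1 !avoid11.
  rewrite conn2 !connE.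
  move: (r w o) (r w b) (r w x) (r w y) => ro rb rx ry.
  by case: (ry =P ro); case: (ro =P rx); case: (ro =P ry); case: (ro =P rb);
    case: (rx =P rb); case: (ry =P rb); case: (ry =P rx); case: (rx =P ry)
    => //= *; congruence.
(* Equal seeds meet in [[set y]]: this is the positive correlation given that [x] and [y] are
   separated. *)
have := reach_avoid_four_functions [set y] [set y] [set x] o b (subxx (edges G)).
have := cross_correlation o b x y (subxx (edges G)).
rewrite setIid (eq_prob _ (fun w _ => avoidC w [set x] [set y])).
have pge0 Q : 0 <= prob p (edges G) Q by apply: prob_ge0; apply: sub_prob.
(* Needed for [0 < d], through [0 <= same < cross <= d]. *)
have : prob p (edges G) (predI (reach_avoid [set y] o [set x])
    (reach_avoid [set x] b [set y])) <=
    prob p (edges G) (fun w => avoid w [set y] [set x]).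
  apply: prob_le => [|w _ /andP[/andP[_ ->]]] //; exact: sub_prob.
move: (pge0 (predI (reach_avoid [set y] o [set x]) (reach_avoid [set y] b [set x]))).
move: (pge0 (reach_avoid [set y] o [set x])).
set oy := prob _ _ (reach_avoid [set y] o [set x]); set d := prob _ _ (fun w => _).
set same := prob _ _ (predI _ _); set cross := prob _ _ (predI _ _).
move=> oy0 same0 crossd crossE sameE lt_sc.
have : same * d < cross * d 
  by rewrite ltr_pM2r // (le_lt_trans same0) // (lt_le_trans lt_sc).
move/(le_lt_trans sameE)/lt_le_trans/(_ crossE).
by apply: contraTT; rewrite -!leNgt => /(ler_wpM2l oy0).
Qed.

End Correlation.

End Exploration.

Theorem theorem1 (R : realType) (G : sgraph) (p : {set G} -> R)
    (hp : edge_probability p) (o b : G) (A : {set G}) (hA : #|A| = 2%N) :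
  percolation p
      (fun w => open_connected w o b && open_connected_set w o A)
  >= \big[Num.min/1]_(a in A)
       percolation p
         (fun w => open_connected_set w o A && open_connected w a b).
Proof.
have /eqP/cards2P[x [y [_ ->]]] := hA.
rewrite leNgt; apply/negP => ltA.
have ltx := lt_le_trans ltA (bigmin_le_cond _ _ (set21 x y)).
have lty := lt_le_trans ltA (bigmin_le_cond _ _ (set22 x y)).
(* Exchanging [x] and [y] yields the reverse strict inequality, a contradiction. *)
rewrite setUC in lty.
have := lt_trans (closer_endpoint hp ltx) (closer_endpoint hp lty).
by rewrite ltxx.
Qed.
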